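(* Let $n\ge1$ and $\mathbf{w}\in\mathbb{Z}_{\ge0}^n$. The maps $\mathsf{T}:\mathbf{P}(\mathbf{w})\to\mathbf{P}(\mathbf{w}^* )$ and $\mathsf{T}':\mathbf{P}(\mathbf{w}^* )\to\mathbf{P}(\mathbf{w})$ are both bijections, and they are inverse to one another.
   Context: **Triangular arrays.** For $\mathbf{w}=(w_1,\dots,w_n)\in\mathbb{Z}_{\ge0}^n$, $\mathbf{P}(\mathbf{w})$ is the set of triangular arrays of size $n$, $Y=(y_{ij})_{1\le i\le n,\,1\le j\le n-i+1}$ of nonnegative integers, with $\sum_{j}y_{ij}=w_i$ for all $i$ and $y_{ij}\ge y_{i-1,j+1}$ for all $i\ge2$ and all $j$. If $Y\in\mathbf{P}(\mathbf{w})$ write $\underline{\dim}(Y)=\mathbf{w}$. Write $\mathbf{w}^*=(w_n,\dots,w_1)$. **Elementary operations.** Let $Y$ be a triangular array of size $n$. - $\mathsf{Del}^{\searrow}(Y)$: array of size $n-1$ with $(i,j)$ entry $y_{i+1,j}$ (top chute deleted). $\mathsf{Del}_{\nearrow}(Y)$: array of size $n-1$ with $(i,j)$ entry $y_{ij}$, $1\le j\le n-i$ (last ladder deleted). $\mathrm{Top}(Y)=(y_{11},\dots,y_{1n})$ (the top chute). - For $Q=(q_1,\dots,q_{n+1})$ nonnegative integers with $q_j\le y_{1,j-1}$ for $2\le j\le n+1$, $Y\cup^{\searrow}Q$ is the array of size $n+1$ with $(i,j)$ entry $q_j$ if $i=1$ and $y_{i-1,j}$ if $i\ge2$. If instead $q_1\ge\cdots\ge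 q_{n+1}$, $Y\cup_{\nearrow}Q$ is the array of size $n+1$ with $(i,j)$ entry $y_{ij}$ if $i\le n$ and $j\le n-i+1$, and $q_{n-i+2}$ if $j=n-i+2$, $1\le i\le n+1$. - $\mathrm{Raise}(Y,i,j)$ (resp. $\mathrm{Lower}(Y,i,j)$) replaces $y_{ij}$ by $y_{ij}+1$ (resp. $y_{ij}-1$). $\mathrm{Raise}$ is defined if $j=1$ or $y_{ij}<y_{i+1,j-1}$; $\mathrm{Lower}$ is defined if $i=1$ and $y_{1j}>0$, or $i>1$ and $y_{ij}>y_{i-1,j+1}$. **Invariants.** For $1\le k\le n$: $\mathcal{I}(Y,k)$ is the smallest $j\ge k$ (with $j\le n$) such that $y_{1j}>0$, or $\infty$ if none. $\mathcal{J}(Y,k)$ is the smallest $j>\mathcal{I}(Y,k)$ (with $j\le n$) such that $y_{1j}<y_{2,j-1}$, if $\mathcal{I}(Y,k)<\infty$ and such a $j$ exists; otherwise $\infty$. For $1\le i\le n-k+1$, $\mathcal{K}_i(Y,k)=\max(\{1\}\cup\{j\mid2\le j\le k,\ y_{ij}<y_{i+1,j-1}\})$. **Procedures.** - $\mathsf{a}(Y,i,k)=(\mathrm{Raise}(Y,i,\mathcal{K}_i(Y,k)),i-1,\mathcal{K}_i(Y,k))$ for $1\le i\le n$, $1\le k\le n-i+1$. - $\mathsf{A}_i(Y)$, $1\le i\le n$, is the array $X$ such that applying $\mathsf{a}$ $i$ times to $(Y,i,n-i+1)$ gives $(X,0,k)$ for some $k$. - $\mathsf{B}(Y,k)$, for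 $1\le k\le n$ with $\mathcal{I}(Y,k)<\infty$, is a pair (array of size $n$, integer) defined by induction on $n$: if $\mathcal{J}(Y,k)=\infty$ (in particular if $n=1$), $\mathsf{B}(Y,k)=(\mathrm{Lower}(Y,1,\mathcal{I}(Y,k)),1)$; if $j_0=\mathcal{J}(Y,k)<\infty$, let $(Z,r)=\mathsf{B}(\mathsf{Del}^{\searrow}(Y),j_0-1)$ and $\mathsf{B}(Y,k)=(\mathrm{Lower}(Z\cup^{\searrow}\mathrm{Top}(Y),1,\mathcal{I}(Y,k)),r+1)$. **Combinatorial Fourier transform $\mathsf{T}$.** By induction on $n$: $\mathsf{T}(Y)=Y$ if $n=1$; for $n>1$, $$\mathsf{T}(Y)=\mathsf{A}_n^{y_{1,n}}\mathsf{A}_{n-1}^{y_{2,n-1}-y_{1,n}}\cdots\mathsf{A}_1^{y_{n,1}-y_{n-1,2}}\big(\mathsf{T}(\mathsf{Del}_{\nearrow}(Y))\cup^{\searrow}(0,\dots,0)\big)$$ (composed right to left; $(0,\dots,0)$ has $n$ entries). **Inverse combinatorial Fourier transform $\mathsf{T}'$.** By induction on $n$: $\mathsf{T}'(Y)=Y$ if $n=1$. For $n>1$, let $(w_1,\dots,w_n)=\underline{\dim}(Y)$, put $Y^{(0)}=Y$ and $(Y^{(m)},q_m)=\mathsf{B}(Y^{(m-1)},1)$ for $m=1,\dots,w_1$ (the top chute of $Y^{(w_1)}$ is zero). Let $P=(p_1,\dots,p_n)$ with $p_j=\#\{m\mid q_m\ge j\}$. Then $\mathsf{T}'(Y)=\mathsf{T}'(\mathsf{Del}^{\searrow}(Y^{(w_1)}))\cup_{\nearrow}P$.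 Both $\mathsf{T}$ and $\mathsf{T}'$ send arrays with dimension vector $\mathbf{w}$ to arrays with dimension vector $\mathbf{w}^*$, for every $\mathbf{w}$. *)

(* Defs.v *)
From HB Require Import structures.
From mathcomp Require Import all_boot.
From mathcomp Require Import boolp classical_sets functions.

Set Implicit Arguments.
Unset Strict Implicit.
Unset Printing Implicit Defensive.

(* Rows i (chutes) and columns j are numbered from 1.  A family of naturals on
   the triangle is an [array n]; the chute inequalities are the separate
   predicate [triangular]. *)
Definition cells (n : nat) : seq (nat * nat) :=
  [seq (i, j) | i <- iota 1 n, j <- iota 1 (n.+1 - i)].

Definition array (n : nat) := {ffun seq_sub (cells n) -> nat}.

(* Reading outside the triangle gives 0; in particular row 0 is zero. *)
Definition entry n (Y : array n) (i j : nat) : nat :=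
  if insub (i, j) is Some c then Y c else 0.

Definition mkarray n (F : nat -> nat -> nat) : array n :=
  [ffun c => F (ssval c).1 (ssval c).2].

Definition triangular n (Y : array n) : Prop :=
  forall i j, 2 <= i <= n -> 1 <= j <= n.+1 - i ->
    entry Y i.-1 j.+1 <= entry Y i j.

Definition dimv n (Y : array n) : n.-tuple nat :=
  [tuple \sum_(1 <= j < (n.+1 - i.+1).+1) entry Y i.+1 j | i < n].

Definition PP n (w : n.-tuple nat) : set (array n) :=
  [set Y | triangular Y /\ dimv Y = w]%classic.

(* The elementary operations are partial in the source, their domains being
   what keeps the result [triangular].  Here they are total, given by the same
   entry formulas; on triangular arrays [fourier] and [fourier_inv] only apply
   them inside those domains. *)
Definition del_top n (Y : array n.+1) : array n :=
  mkarray n (fun i j => entry Y i.+1 j).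

Definition del_last n (Y : array n.+1) : array n :=
  mkarray n (fun i j => entry Y i j).

Definition top n (Y : array n) : n.-tuple nat :=
  [tuple entry Y 1 j.+1 | j < n].

Definition cup_top n (Y : array n) (Q : n.+1.-tuple nat) : array n.+1 :=
  mkarray n.+1 (fun i j => if i == 1 then nth 0 Q j.-1 else entry Y i.-1 j).

Definition cup_last n (Y : array n) (Q : n.+1.-tuple nat) : array n.+1 :=
  mkarray n.+1 (fun i j => if i + j == n.+2 then nth 0 Q j.-1 else entry Y i j).

Definition raise n (Y : array n) (i j : nat) : array n :=
  mkarray n (fun i' j' =>
    if (i', j') == (i, j) then (entry Y i' j').+1 else entry Y i' j').

Definition lower n (Y : array n) (i j : nat) : array n :=
  mkarray n (fun i' j' =>
    if (i', j') == (i, j) then (entry Y i' j').-1 else entry Y i' j').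

(* [None] stands for infinity. *)
Definition invI n (Y : array n) (k : nat) : option nat :=
  ohead [seq j <- iota k (n.+1 - k) | 0 < entry Y 1 j].

Definition invJ n (Y : array n) (k : nat) : option nat :=
  if invI Y k is Some j1
  then ohead [seq j <- iota j1.+1 (n - j1) | entry Y 1 j < entry Y 2 j.-1]
  else None.

Definition invK n (Y : array n) (i k : nat) : nat :=
  maxn 1 (\max_(2 <= j < k.+1 | entry Y i j < entry Y i.+1 j.-1) j).

Definition proc_a n (s : array n * nat * nat) : array n * nat * nat :=
  let: (Y, i, k) := s in (raise Y i (invK Y i k), i.-1, invK Y i k).

Definition proc_A n (i : nat) (Y : array n) : array n :=
  (iter i (@proc_a n) (Y, i, n.+1 - i)).1.1.

(* The value (Y, 0) is a dummy, for the excluded cases n = 0 and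
   invI Y k = None. *)
Fixpoint proc_B n : array n -> nat -> array n * nat :=
  match n with
  | 0 => fun Y _ => (Y, 0)
  | m.+1 => fun Y k =>
      match invI Y k, invJ Y k with
      | Some i0, None => (lower Y 1 i0, 1)
      | Some i0, Some j0 =>
          let: (Z, r) := proc_B (del_top Y) j0.-1 in
          (lower (cup_top Z (top Y)) 1 i0, r.+1)
      | None, _ => (Y, 0)
      end
  end.

(* For i = n the subtracted entry lies in row 0, so the exponent of A_n is
   y_{1,n}; [foldl] applies A_1 first and A_n last. *)
Fixpoint fourier n : array n -> array n :=
  match n with
  | 0 => id
  | m.+1 => fun Y =>
      let n := m.+1 in
      if n == 1 then Y else
      foldl (fun X i =>
               iter (entry Y (n.+1 - i) i - entry Y (n - i) i.+1)
                    (@proc_A n i) X)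
            (cup_top (fourier (del_last Y)) [tuple 0 | _ < n])
            (iota 1 n)
  end.

(* [B_seq Y m] is the pair of Y^(m) and the sequence q_1, ..., q_m. *)
Fixpoint B_seq n (Y : array n) (m : nat) : array n * seq nat :=
  if m is m'.+1 then
    let: (X, qs) := B_seq Y m' in
    let: (X', q) := proc_B X 1 in (X', rcons qs q)
  else (Y, [::]).

Fixpoint fourier_inv n : array n -> array n :=
  match n with
  | 0 => id
  | m.+1 => fun Y =>
      let n := m.+1 in
      if n == 1 then Y else
      let: (X, qs) := B_seq Y (tnth (dimv Y) ord0) in
      cup_last (fourier_inv (del_top X))
               [tuple count (fun q => j.+1 <= q) qs | j < n]
  end.

(* Main.v *)
Require Import Defs.
From mathcomp Require Import all_boot.
From mathcomp Require Import boolp classical_sets functions.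
From mathcomp Require Import zify.

Set Implicit Arguments.
Unset Strict Implicit.
Unset Printing Implicit Defensive.

(** An application of [A_q] raises one entry in each of the rows [q, ..., 1];
    call the raised cells a path.  Going up, the columns of the path decrease
    weakly, and in each row the path turns as far right as it may.  An
    application of [B] from column 1 lowers one entry in each of the rows
    [1, ..., q], where [q] is its output; going down, the columns increase
    weakly, and in each row the path stops as far left as it may.  The two
    greedy rules are the same condition on the pair (array before, array
    after), read from the two ends.  It is the relation [slide] below: a
    weakly increasing column function [c] such that every entry of row [r]
    strictly right of the path, up to the column [c r.+1], is already as large
    as the ladder inequality allows.  [proc_A] produces the only slide of
    length [q] out of a given array ([proc_A_slide], [slide_proc_A]).
    [proc_B] produces the only slide into a given array that starts at the
    first nonzero entry of the top chute ([proc_B_slide], [proc_B_uniq]).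
    So the two operations are mutually inverse, except that a slide made by
    [A] need not start at that entry.

    Comparing two successive paths settles when it does.  Raising a path no
    shorter than the previous one gives a path weakly left of it
    ([slide_weakly_left]), which therefore starts at or before the first
    nonzero entry of the top chute.  Conversely, lowering twice gives a second path
    weakly right of the first and no longer than it ([slide_weakly_right]).
    Hence, for an array [Z] with zero top chute, applying [A_q] for [q]
    running through a weakly increasing list, and peeling paths off with [B]
    until the top chute vanishes, are inverse processes; the relation
    [peeling] records them, with the lengths in the order in which [B]
    delivers them.

    The list of lengths used by the Fourier transform is the conjugate of the
    last ladder, viewed as a partition, and the inverse transform rebuilds the
    last ladder as the conjugate of the list of lengths.  The theorem follows
    by induction on the size, both transforms being a peeling together with
    the transform of the array with one ladder, or one chute, fewer.  A path of
    length [q] adds 1 to the sums of rows [1, ..., q], while the part [q] of the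
    conjugate of the last ladder adds 1 to the sums of rows [n.+1 - q, ..., n];
    so the dimension vector is reversed. *)

(** * Entries of arrays *)

Definition in_triangle n i j := [&& 0 < i, 0 < j & i + j <= n.+1].

Lemma mem_cells n i j : ((i, j) \in cells n) = in_triangle n i j.
Proof.
apply/allpairsPdep/idP => [[a [b []]]|].
  by rewrite !mem_iota => ? ? [-> ->]; rewrite /in_triangle; lia.
by rewrite /in_triangle => ?; exists i, j; rewrite !mem_iota; split; [lia..|].
Qed.

Lemma entry_mkarray n F i j :
  entry (mkarray n F) i j = if in_triangle n i j then F i j else 0.
Proof.
rewrite /entry -mem_cells; case: insubP => [c -> ec|/negbTE-> //].
by rewrite ffunE -[ssval c]/(val c) ec.
Qed.

Lemma entry_out n (Y : array n) i j : ~~ in_triangle n i j -> entry Y i j = 0.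
Proof. by rewrite -mem_cells /entry => out; rewrite insubN. Qed.

Lemma array_eq n (X Y : array n) : entry X =2 entry Y -> X = Y.
Proof.
move=> eXY; apply/ffunP => c; have := eXY (val c).1 (val c).2.
by rewrite /entry -surjective_pairing valK.
Qed.

(** Because reading outside the triangle gives 0, the ladder inequalities hold
    at all indices with positive column: a ladder lies entirely inside or
    entirely outside the triangle, apart from its end in row 0. *)
Lemma triangularP n (Y : array n) :
  triangular Y <-> forall i j, entry Y i j.+2 <= entry Y i.+1 j.+1.
Proof.
split=> [tY i j|tY [|i] [|j] //= *].
have [/and3P[? ? ?]|/entry_out->//] := boolP (in_triangle n i j.+2).
by apply: (tY i.+1); lia.
Qed.

Lemma triangular_le n (Y : array n) i j :
  triangular Y -> 1 < j -> entry Y i j <= entry Y i.+1 j.-1.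
Proof. by case: j => [|[|j]] // /triangularP + _; exact. Qed.

Lemma entry_raise n (Y : array n) i j i' j' : in_triangle n i j ->
  entry (raise Y i j) i' j' = entry Y i' j' + ((i' == i) && (j' == j)).
Proof.
move=> hij; rewrite entry_mkarray xpair_eqE.
case: ifPn => [_|out]; first by case: ifP => _; lia.
rewrite entry_out //; case: eqP => [ei|//]; case: eqP => [ej|//].
by rewrite ei ej hij in out.
Qed.

Lemma entry_lower n (Y : array n) i j i' j' :
  entry (lower Y i j) i' j' = entry Y i' j' - ((i' == i) && (j' == j)).
Proof.
rewrite entry_mkarray xpair_eqE.
case: ifPn => [_|/entry_out->//]; by case: ifP => _; lia.
Qed.

Lemma entry_del_top n (Y : array n.+1) i j :
  entry (del_top Y) i j = if 0 < i then entry Y i.+1 j else 0.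
Proof.
rewrite entry_mkarray; case: (boolP (in_triangle _ _ _)) => [/and3P[-> //]|out].
by case: ifP => // i0; rewrite entry_out //; move: out; rewrite /in_triangle; lia.
Qed.

Lemma triangular_del_top n (Y : array n.+1) : triangular Y -> triangular (del_top Y).
Proof.
move=> tY; apply/triangularP => i j; rewrite !entry_del_top.
by case: i => //= i; move/triangularP: tY.
Qed.

Lemma entry_cup_top n (Y : array n) (Q : n.+1.-tuple nat) i j :
  entry (cup_top Y Q) i j =
    if i == 1 then (if 0 < j then nth 0 Q j.-1 else 0) else entry Y i.-1 j.
Proof.
rewrite entry_mkarray; case: (boolP (in_triangle _ _ _)) => [/and3P[i0 -> ?]//|out].
case: eqP => [i1|ni1].
  case: ifP => // j0; rewrite nth_default // size_tuple.
  by move: out; rewrite /in_triangle; lia.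
by rewrite entry_out //; move: out; rewrite /in_triangle; lia.
Qed.

Lemma entry_del_last n (Y : array n.+1) i j :
  entry (del_last Y) i j = if i + j <= n.+1 then entry Y i j else 0.
Proof.
rewrite entry_mkarray; case: (boolP (in_triangle _ _ _)) => [/and3P[_ _ ->//]|out].
by case: ifP => // ij; rewrite entry_out //; move: out; rewrite /in_triangle; lia.
Qed.

Lemma entry_cup_last n (Y : array n) (Q : n.+1.-tuple nat) i j :
  entry (cup_last Y Q) i j =
    if [&& i + j == n.+2, 0 < i & 0 < j] then nth 0 Q j.-1 else entry Y i j.
Proof.
rewrite entry_mkarray; case: (boolP (in_triangle _ _ _)) => [/and3P[-> -> ?]|out].
  by rewrite !andbT.
rewrite ifF; last by move: out; rewrite /in_triangle; lia.
by rewrite entry_out //; move: out; rewrite /in_triangle; lia.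
Qed.

(** * Slides *)

(** The path has cells [(r, c r)] for [p < r <= q]; the value [p = 0] is that of
    a complete path, and [p > 0] occurs while [A_q] is being computed.  The
    value [c q.+1] is the length of row [q], so that the bottom row obeys the
    same conditions as the others.  The maximality condition [slide_max] is
    stated for [X], but it constrains only cells off the path and so says the
    same of [Y]: it is both the greedy rule of [A] for [X] and that of [B]
    for [Y]. *)
Record slide n p q (c : nat -> nat) (X Y : array n) : Prop := Slide {
  slide_q : 0 < q <= n;
  slide_end : c q.+1 = n.+1 - q;
  slide_gt0 : forall r, p < r <= q -> 0 < c r;
  slide_mono : forall r, p < r <= q -> c r <= c r.+1;
  slide_max : forall r j, p < r <= q -> c r < j <= c r.+1 ->
    entry X r.+1 j.-1 <= entry X r j;
  slide_entry : forall i j,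
    entry Y i j = entry X i j + ((p < i <= q) && (j == c i));
  slide_src : triangular X;
  slide_tgt : triangular Y }.

Lemma slide_bound n p q c (X Y : array n) r :
  slide p q c X Y -> p < r <= q.+1 -> c r <= n.+1 - q.
Proof.
move=> S; have [t er] : exists t, t = q.+1 - r by exists (q.+1 - r).
elim: t r er => [|t IH] r er hr.
  by rewrite -(slide_end S); have -> : r = q.+1 by lia.
by apply: leq_trans (slide_mono S _) (IH r.+1 _ _); lia.
Qed.

(** * Existence and uniqueness of the raising slide *)

Lemma invKP n (Y : array n) i k : 0 < k ->
  let j := Defs.invK Y i k in
  [/\ 0 < j <= k, 1 < j -> entry Y i j < entry Y i.+1 j.-1
    & forall j', j < j' <= k -> entry Y i.+1 j'.-1 <= entry Y i j'].
Proof.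
move=> k0 j; rewrite {}/j /Defs.invK.
set M := \max_(_ <= _ < _ | _) _.
have [M0|[M2 Mlt]] : M = 0 \/ 2 <= M <= k /\ entry Y i M < entry Y i.+1 M.-1.
- rewrite /M big_nat_cond.
  elim/big_ind: _ => [|x y hx hy|j /andP[hj ?]]; [by left| |].
    by case: (leqP x y) => _.
  by right; split; [lia|].
- split; [lia|lia|move=> j' hj; rewrite leqNgt; apply/negP => jlt].
  suff : j' <= M by lia.
  apply: (leq_bigmax_seq (F := id) j'); last exact: jlt.
  by rewrite mem_index_iota; lia.
- split; [lia|by have -> : maxn 1 M = M by lia|].
  move=> j' hj; rewrite leqNgt; apply/negP => jlt.
  suff : j' <= M by lia.
  apply: (leq_bigmax_seq (F := id) j'); last exact: jlt.
  by rewrite mem_index_iota; lia.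
Qed.

(** The rule of [A] looks at row [p.+1] only up to the column [c p.+2], hence
    only at entries of rows [p.+1] and [p.+2] that the path leaves alone. *)
Lemma slide_proc_a n p q c (X Y : array n) : slide p.+1 q c X Y -> p < q ->
  let j := Defs.invK Y p.+1 (c p.+2) in
  slide p q (fun r => if r == p.+1 then j else c r) X (raise Y p.+1 j).
Proof.
move=> S pq.
have k0 : 0 < c p.+2.
  have [h|h] := ltnP p.+1 q; first by apply: (slide_gt0 S); lia.
  have -> : p.+2 = q.+1 by lia.
  by rewrite (slide_end S); have := slide_q S; lia.
have kle : c p.+2 <= n.+1 - q by apply: (slide_bound S); lia.
have [] := invKP Y p.+1 k0.
set j := Defs.invK _ _ _ => /= j0 jlt jmax.
have inj : in_triangle n p.+1 j by have := slide_q S; rewrite /in_triangle; lia.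
have [sq se sg sm sx sE tX tY] := S.
split=> //.
- by rewrite ifF //; lia.
- by move=> r hr; case: eqP => e; [lia|apply: sg; lia].
- move=> r hr; case: eqP => e; first by rewrite e ifF ?eqSS; lia.
  by rewrite ifF; [apply: sm; lia|lia].
- move=> r j' hr; case: (r =P p.+1) => [->|e].
    rewrite ifF; last by lia.
    move=> hj; have := jmax _ hj; rewrite !sE.
    by case: eqP; case: eqP; lia.
  by rewrite ifF; [apply: sx; lia|lia].
- move=> i' j'; rewrite entry_raise // sE.
  by case: (i' =P p.+1) => [->|e]; rewrite ?ltnn /=; lia.
- apply/triangularP => a b; rewrite !entry_raise //.
  have /triangularP/(_ a b) := tY.
  case: (a =P p.+1) => [ea|ea]; case: (b.+2 =P j) => [eb|eb] /=; [|lia..].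
  by move: jlt; rewrite ea -eb /=; lia.
Qed.

Lemma iter_proc_a n q t (X : array n) : 0 < q <= n -> triangular X -> t <= q ->
  exists c Y, iter t (@proc_a n) (X, q, n.+1 - q) = (Y, q - t, c (q - t).+1)
    /\ slide (q - t) q c X Y.
Proof.
move=> hq tX; elim: t => [|t IH] ht.
  exists (fun _ => n.+1 - q), X; rewrite subn0; split=> //.
  by split=> // *; lia.
have [c [Y [eY S]]] := IH (ltnW ht).
have ep : q - t = (q - t.+1).+1 by lia.
rewrite ep in eY S; eexists _, _; split; last by apply: slide_proc_a S _; lia.
by rewrite iterS eY /= eqxx.
Qed.

Lemma proc_A_slide n q (X : array n) : 0 < q <= n -> triangular X ->
  exists c, slide 0 q c X (proc_A q X).
Proof.
move=> hq tX; have [c [Y [eY S]]] := iter_proc_a hq tX (leqnn q).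
by exists c; rewrite /proc_A eY; rewrite subnn in S.
Qed.

(** At the bottom both paths are bounded by the length of row [q'], and one goes
    up row by row.  Were [c] strictly right of [c'] in row [r], maximality of [c']
    would make that entry of [X'] as large as the ladder inequality allows, and
    [X] agrees with [X'] at the entry bounding it; raising it would break
    triangularity of [Y].  The two uses are [X = X'] (uniqueness) and [X = Y']
    (successive paths). *)
Lemma slide_weakly_left n q q' c c' (X Y X' Y' : array n) :
    slide 0 q c X Y -> slide 0 q' c' X' Y' -> q' <= q ->
    (forall i j, entry X' i j <= entry X i j) ->
    (forall i j, i <= q'.+1 -> j < c' i -> entry X i j = entry X' i j) ->
  forall r, 0 < r <= q'.+1 -> c r <= c' r.
Proof.
move=> S S' qq leX eqX r; have [t er] : exists t, t = q'.+1 - r by eexists.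
elim: t r er => [|t IH] r er hr.
  have -> : r = q'.+1 by lia.
  by rewrite (slide_end S'); apply: leq_trans (slide_bound S _) _; lia.
have hc : c r <= c' r.+1 by apply: leq_trans (slide_mono S _) (IH _ _ _); lia.
rewrite leqNgt; apply/negP => lt.
have r1 : r <= q' by lia.
have max' : entry X' r.+1 (c r).-1 <= entry X' r (c r).
  by apply: (slide_max S'); lia.
have g' : 0 < c' r by apply: (slide_gt0 S'); lia.
have := triangular_le r (slide_tgt S) (leq_ltn_trans g' lt).
rewrite !(slide_entry S) eqxx (eqX r.+1); [|lia|lia].
have cm : c r <= c r.+1 by apply: (slide_mono S); lia.
have -> : (c r).-1 == c r.+1 = false by lia.
by have := leX r (c r); lia.
Qed.

Lemma slide_proc_A n q c (X Y : array n) : slide 0 q c X Y -> proc_A q X = Y.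
Proof.
move=> S; have [c' S'] := proc_A_slide (slide_q S) (slide_src S).
have cE r : 0 < r <= q -> c' r = c r.
  move=> hr; apply/eqP; rewrite eqn_leq.
  by rewrite (slide_weakly_left S' S) ?(slide_weakly_left S S') //; lia.
apply: array_eq => i j; rewrite (slide_entry S') (slide_entry S).
by case: (boolP (0 < i <= q)) => // hi; rewrite cE.
Qed.

(** * Existence and uniqueness of the lowering slide *)

Variant first_spec (P : pred nat) a b : option nat -> Prop :=
| FirstSome j of a <= j < b & P j & (forall i, a <= i < j -> ~~ P i) :
    first_spec P a b (Some j)
| FirstNone of (forall i, a <= i < b -> ~~ P i) : first_spec P a b None.

Lemma firstP (P : pred nat) a m b : a + m = b ->
  first_spec P a b (ohead [seq j <- iota a m | P j]).
Proof.
move=> <- {b}; elim: m a => [|m IH] a /=; first by constructor=> i; lia.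
case: ifPn => Pa /=; first by constructor=> //; lia.
have sk i : a <= i -> ~~ P i \/ a.+1 <= i.
  by rewrite leq_eqVlt => /orP[/eqP<-|]; [left|right].
case: IH => [j hj Pj low|low].
  by constructor=> // [|i hi]; [lia|case: (sk i) => [|//|]; [|move=> ?; apply: low]; lia].
by constructor=> i hi; case: (sk i) => [|//|?]; [|apply: low]; lia.
Qed.

(** The recursive call starts at column [j0.-1] of the second row, where the entry
    is positive because it exceeds the one above it on its ladder; so the path
    of the smaller array starts exactly there, and prepending the cell
    [(1, i0)] extends it.  When there is no [j0], the first row alone is a
    maximal path. *)
Lemma proc_B_slide n (Y : array n) k : triangular Y -> 0 < k ->
    (exists2 j, k <= j <= n & 0 < entry Y 1 j) ->
  exists X q c, [/\ proc_B Y k = (X, q), slide 0 q c X Y, k <= c 1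
    & forall j, k <= j < c 1 -> entry Y 1 j = 0].
Proof.
elim: n => [|n IH] in Y k *; first by move=> _ k0 [j]; lia.
move=> tY k0 [jx hjx Yjx]; rewrite /=.
rewrite /invJ /invI.
have kb : k + (n.+2 - k) = n.+2 by lia.
case: (firstP (fun j => 0 < entry Y 1 j) kb) => [i0 hi0 Yi0 low|/(_ jx)]; last first.
  by rewrite Yjx; lia.
have ib : i0.+1 + (n.+1 - i0) = n.+2 by lia.
case: (firstP (fun j => entry Y 1 j < entry Y 2 j.-1) ib) => [j0 hj0 Yj0 jlow|jlow].
- have [|||Z [r [c [-> S c1 c1low]]]] := IH (del_top Y) j0.-1; [|lia| |].
  + exact: triangular_del_top.
  + exists j0.-1; first lia.
    by rewrite entry_del_top /=; lia.
  have ec1 : c 1 = j0.-1.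
    apply/eqP; rewrite eqn_leq c1 andbT leqNgt; apply/negP => lt.
    have := c1low j0.-1; rewrite leqnn lt entry_del_top /= => /(_ isT) e0.
    by rewrite e0 in Yj0.
  have [sq se sg sm sx sE tZ _] := S.
  set X := lower _ 1 i0.
  have XE i j : entry Y i j =
      entry X i j + ((0 < i <= r.+1) && (j == if i == 1 then i0 else c i.-1)).
    rewrite /X entry_lower entry_cup_top /=.
    case: (i =P 1) => [->|ni] /=.
      case: (posnP j) => [->|j0'].
        by rewrite entry_out /in_triangle //; lia.
      have -> : nth 0 (top Y) j.-1 = entry Y 1 j.
        have [jn|jn] := ltnP j.-1 n.+1.
          rewrite -[j.-1]/(nat_of_ord (Ordinal jn)) -tnth_nth tnth_mktuple.
          by congr entry => /=; lia.
        rewrite nth_default ?size_tuple // entry_out // /in_triangle; lia.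
      by case: (j =P i0) => [->|]; lia.
    case: i ni => [|[|i]] // _.
      by rewrite !entry_out // /in_triangle; lia.
    by have := sE i.+1 j; rewrite entry_del_top /=; lia.
  exists X, r.+1, (fun i => if i == 1 then i0 else c i.-1); split=> //=; last first.
  + by move=> j hj; have := low j; lia.
  + by case/andP: hi0.
  have tX : triangular X.
    apply/triangularP => i j; have /triangularP/(_ i j) := tY.
    have := XE i j.+2; have := XE i.+1 j.+1.
    case: i => [|[|i]] /=.
    * by rewrite [entry X 0 _]entry_out.
    * rewrite ec1; case: (j.+1 =P j0.-1) => [ej|]; last by lia.
      by move: Yj0; have -> : j0 = j.+2 by [lia]; rewrite /=; lia.
    * have /triangularP/(_ i.+1 j) := tZ.
      by have := sE i.+1 j.+2; have := sE i.+2 j.+1; rewrite !entry_del_top /=; lia.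
  split=> //; first lia.
  + by move=> i hi; case: eqP => e; [lia|apply: sg; lia].
  + case=> [//|[|i]] hi /=; first by rewrite ec1; lia.
    by apply: (sm i.+1); lia.
  + case=> [//|[|i]] j hi /=.
      rewrite ec1 => hj; have := jlow j; have := XE 1 j; have := XE 2 j.-1.
      by rewrite /= ec1; lia.
    move=> hj; have := sx i.+1 j; have := XE i.+2 j; have := XE i.+3 j.-1.
    have := sE i.+1 j; have := sE i.+2 j.-1.
    by rewrite !entry_del_top /=; lia.
- have XE i j : entry Y i j =
      entry (lower Y 1 i0) i j + ((0 < i <= 1) && (j == i0)).
    rewrite entry_lower; case: (i =P 1) => [->|ni] /=; last by lia.
    by case: (j =P i0) => [->|]; lia.
  exists (lower Y 1 i0), 1, (fun i => if i == 1 then i0 else n.+1); split=> //; last first.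
  + by move=> j /= hj; have := low j; lia.
  + by case/andP: hi0.
  split=> //=.
  + by move=> r hr; rewrite ifT; lia.
  + by move=> r hr; rewrite ifT ?ifF; lia.
  + move=> r j hr; have -> : r = 1 by lia.
    move=> /= hj; have := jlow j; have := XE 1 j; have := XE 2 j.-1.
    by rewrite /= => -> ->; lia.
  + by move=> i j; rewrite XE; case: (i =P 1) => [->|ni] //; congr (_ + _); lia.
  + apply/triangularP => i j; have /triangularP/(_ i j) := tY.
    have := XE i j.+2; have := XE i.+1 j.+1.
    by case: i => [|i] /=; rewrite ?[entry _ 0 _]entry_out //; lia.
Qed.

(** [c] starts at the first nonzero entry of the top chute of [Y], and [c'] at
    some nonzero entry of it.  Going down, if [c] were strictly right of [c'] in row [r.+1], or had already
    ended, maximality of [c] would apply to the column just after [c' r.+1]: the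
    entry of [Y] at [c' r.+1] would not exceed the one above it on its ladder,
    so it could not be lowered, in [Y] or in the smaller [Y'].  The two uses are
    [Y' = Y] (uniqueness) and [Y' = X] (successive paths). *)
Lemma slide_weakly_right n q q' c c' (X Y X' Y' : array n) :
    slide 0 q c X Y -> slide 0 q' c' X' Y' ->
    (forall j, j < c 1 -> entry Y 1 j = 0) ->
    (forall i j, entry Y' i j <= entry Y i j) ->
    (forall i j, 0 < i <= q -> c i < j -> entry Y' i j = entry Y i j) ->
  forall r, 0 < r <= q' -> r <= q /\ c r <= c' r.
Proof.
move=> S S' front leY eqY; have sq := slide_q S.
elim=> [//|[|r] IH] hr.
  split; first by lia.
  rewrite leqNgt; apply/negP => lt; have := leY 1 (c' 1).
  by rewrite front // (slide_entry S') eqxx hr; lia.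
have [rq cr] : r.+1 <= q /\ c r.+1 <= c' r.+1 by apply: IH; lia.
suff lt : c r.+2 <= c' r.+2 /\ r.+1 < q by lia.
have c1 : c' r.+1 <= c' r.+2 by apply: (slide_mono S'); lia.
have c'b : c' r.+2 <= n.+1 - q' by apply: (slide_bound S'); lia.
suff nlt : ~~ (c' r.+2 < c r.+2).
  split; first by lia.
  have [//|qr] := ltnP r.+1 q; have e : r.+1 = q by lia.
  by have := slide_end S; rewrite -e; lia.
apply/negP => lt.
(* In column [(c' r.+2).+1] the entry of row [r.+1] is the one above the cell
   [(r.+2, c' r.+2)] on its ladder. *)
have max1 : entry X r.+2 (c' r.+2) <= entry X r.+1 (c' r.+2).+1.
  by apply: (slide_max S (j := (c' r.+2).+1)); lia.
have g' : 0 < c' r.+2 by apply: (slide_gt0 S'); lia.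
have := triangular_le (j := (c' r.+2).+1) r.+1 (slide_src S') g' => /=.
have := slide_entry S' r.+1 (c' r.+2).+1; have := slide_entry S' r.+2 (c' r.+2).
have := slide_entry S r.+1 (c' r.+2).+1; have := slide_entry S r.+2 (c' r.+2).
have := leY r.+2 (c' r.+2).
by have := eqY r.+1 (c' r.+2).+1; lia.
Qed.

(** * Row sums and the output of [B] *)

Definition weight n (Y : array n) i := \sum_(1 <= j < (n.+1 - i).+1) entry Y i j.

Lemma tnth_dimv n (Y : array n) (k : 'I_n) : tnth (dimv Y) k = weight Y k.+1.
Proof. by rewrite tnth_mktuple. Qed.

Lemma slide_weight n q c (X Y : array n) i : slide 0 q c X Y -> 0 < i ->
  weight Y i = weight X i + (i <= q).
Proof.
move=> S i0; rewrite /weight (eq_bigr _ (fun j _ => slide_entry S i j)).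
rewrite big_split /=; congr (_ + _); rewrite i0 /=.
have [iq|_] := leqP i q; last by rewrite big1.
rewrite (bigD1_seq (c i)) ?iota_uniq //=; last first.
  rewrite mem_index_iota; have := slide_bound S (r := i); have := slide_gt0 S (r := i).
  by have := slide_q S; lia.
by rewrite eqxx big1 // => j /negbTE->.
Qed.

Lemma weight1_eq0 n (Y : array n) :
  weight Y 1 = 0 <-> forall j, entry Y 1 j = 0.
Proof.
split=> [/eqP|Y0]; last by rewrite /weight big1.
rewrite /weight sum_nat_seq_eq0 => /allP Y0 j.
have [/and3P[_ j0 jn]|/entry_out->//] := boolP (in_triangle n 1 j).
by apply/eqP/Y0; rewrite mem_index_iota; lia.
Qed.

Lemma proc_B_uniq n q c (X Y : array n) : slide 0 q c X Y ->
  (forall j, j < c 1 -> entry Y 1 j = 0) -> proc_B Y 1 = (X, q).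
Proof.
move=> S front; have sq := slide_q S.
have [|X' [q' [c' [-> S' _ front']]]] := @proc_B_slide n Y 1 (slide_tgt S) isT.
  exists (c 1); last by rewrite (slide_entry S) eqxx; lia.
  by rewrite (slide_gt0 S) //; have := slide_bound S (r := 1); lia.
have f' j : j < c' 1 -> entry Y 1 j = 0.
  case: j => [|j] hj; first by rewrite entry_out // /in_triangle andbF.
  by apply: front'.
have h := slide_weakly_right S S' front (fun _ _ => leqnn _) (fun _ _ _ _ => erefl).
have h' := slide_weakly_right S' S f' (fun _ _ => leqnn _) (fun _ _ _ _ => erefl).
have sq' := slide_q S'.
have eq : q' = q.
  by have [] := h q'; [lia|]; have [] := h' q; lia.
rewrite eq in h h' S' *; congr (_, _); apply: array_eq => i j.
have := slide_entry S i j; have := slide_entry S' i j.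
case: (boolP (0 < i <= q)) => hi; last by lia.
by have -> : c' i = c i by [have := h i hi; have := h' i hi; lia]; lia.
Qed.

(** * Peelings *)

(** [qs] lists the lengths in the order of [B], so it is weakly decreasing, and
    [A] is applied along [qs] from its end: [Y = foldr A Z qs]. *)
Inductive peeling n : array n -> seq nat -> array n -> Prop :=
| PeelNil Z of triangular Z & (forall j, entry Z 1 j = 0) : peeling Z [::] Z
| PeelCons Y X Z q qs c of slide 0 q c X Y
    & (forall j, j < c 1 -> entry Y 1 j = 0)
    & path geq q qs & peeling X qs Z : peeling Y (q :: qs) Z.

Lemma peeling_src n (Y Z : array n) qs : peeling Y qs Z -> triangular Y.
Proof. by case=> // ? ? ? ? ? ? /slide_tgt. Qed.

Lemma peeling_tgt n (Y Z : array n) qs : peeling Y qs Z -> triangular Z.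
Proof. by elim. Qed.

Lemma peeling_top0 n (Y Z : array n) qs :
  peeling Y qs Z -> forall j, entry Z 1 j = 0.
Proof. by elim. Qed.

Lemma peeling_sorted n (Y Z : array n) qs : peeling Y qs Z -> sorted geq qs.
Proof. by case. Qed.

Lemma peeling_range n (Y Z : array n) qs :
  peeling Y qs Z -> all (fun q => 0 < q <= n) qs.
Proof.
by elim=> //= {}Y X {}Z q {}qs c /slide_q ? _ _ _ ->; rewrite andbT.
Qed.

Lemma peeling_weight n (Y Z : array n) qs i : peeling Y qs Z -> 0 < i ->
  weight Y i = weight Z i + count (leq i) qs.
Proof.
move=> P i0; elim: P => [*|{}Y X {}Z q {}qs c S _ _ _ IH]; first by rewrite addn0.
by rewrite (slide_weight S i0) IH /=; lia.
Qed.

Lemma peeling_size n (Y Z : array n) qs : peeling Y qs Z -> weight Y 1 = size qs.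
Proof.
move=> P; rewrite (peeling_weight P) //.
rewrite ((weight1_eq0 Z).2 (peeling_top0 P)) add0n; apply/eqP.
rewrite -all_count; apply: sub_all (peeling_range P).
by move=> q /andP[].
Qed.

Lemma peeling_foldr n (Y Z : array n) qs :
  peeling Y qs Z -> foldr (@proc_A n) Z qs = Y.
Proof.
by elim=> //= {}Y X {}Z q {}qs c S _ _ _ ->; apply: slide_proc_A S.
Qed.

Lemma B_seqS n (Y : array n) m : B_seq Y m.+1 =
  let: (X, q) := proc_B Y 1 in let: (Z, qs) := B_seq X m in (Z, q :: qs).
Proof.
elim: m => [|m IH] /=; first by case: (proc_B Y 1).
move: IH => /= ->; case: (proc_B Y 1) => X q.
by case: (B_seq X m) => Z qs; case: (proc_B Z 1).
Qed.

Lemma peeling_B_seq n (Y Z : array n) qs :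
  peeling Y qs Z -> B_seq Y (size qs) = (Z, qs).
Proof.
elim=> // {}Y X {}Z q {}qs c S front _ _ IH.
by rewrite [size _]/= B_seqS (proc_B_uniq S front) IH.
Qed.

(** The condition that the new path start at the first nonzero entry of the top
    chute is not imposed: it results from the new path being no shorter than
    the last one, hence weakly left of it. *)
Lemma peeling_proc_A n (Y Z : array n) q qs : peeling Y qs Z ->
  0 < q <= n -> path geq q qs -> peeling (proc_A q Y) (q :: qs) Z.
Proof.
move=> P hq qqs; have [c S] := proc_A_slide hq (peeling_src P).
apply: PeelCons (S) _ (qqs) (P) => j hj; rewrite (slide_entry S).
rewrite (ltn_eqF hj) andbF addn0.
case: P qqs S => [//|{}Y X {}Z q' {}qs c' S' front _ _ /= /andP[q'q _] S].
apply: front; apply: leq_trans hj _.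
apply: (slide_weakly_left S S') => //.
- by move=> a b; rewrite (slide_entry S') leq_addr.
- move=> a b ha hb; rewrite (slide_entry S').
  by have -> : b == c' a = false by [lia]; lia.
Qed.

Lemma peeling_of_foldr n (Z : array n) qs :
    triangular Z -> (forall j, entry Z 1 j = 0) ->
    sorted geq qs -> all (fun q => 0 < q <= n) qs ->
  peeling (foldr (@proc_A n) Z qs) qs Z.
Proof.
move=> tZ Z0; elim: qs => [|q qs IH] /= sqs; first by constructor.
case/andP=> hq hqs; apply: peeling_proc_A => //.
by apply: IH => //; apply: path_sorted sqs.
Qed.

(** Here the decrease of the lengths results from the comparison of successive
    lowered paths.  The process stops since each path takes 1 from the weight of
    the top chute. *)
Lemma peeling_exists n (Y : array n) :
  triangular Y -> exists qs Z, peeling Y qs Z.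
Proof.
have [m] := ubnP (weight Y 1); elim: m Y => // m IH Y hm tY.
have [Y0|Y0] := pselect (forall j, entry Y 1 j = 0).
  by exists [::], Y; constructor.
have [|X [q [c [_ S _ front]]]] := @proc_B_slide n Y 1 tY isT.
  apply: contrapT => no; apply: Y0 => j.
  have [/and3P[_ j0 jn]|/entry_out->//] := boolP (in_triangle n 1 j).
  by have [//|Yj] := posnP (entry Y 1 j); case: no; exists j => //; lia.
have [|qs [Z P]] := IH X _ (slide_src S).
  by move: hm; rewrite (slide_weight S) //; have := slide_q S; lia.
exists (q :: qs), Z; have front1 j : j < c 1 -> entry Y 1 j = 0.
  case: j => [|j] hj; first by rewrite entry_out // /in_triangle andbF.
  by apply: front.
apply: PeelCons (S) (front1) _ (P).
case: P S => [//|{}X X' {}Z q' {}qs c' S' _ qqs _ S] /=; rewrite qqs andbT.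
have [] // := slide_weakly_right S S' front1 _ _ (r := q').
- by move=> i j; rewrite (slide_entry S) leq_addr.
- by move=> i j _ hj; rewrite (slide_entry S) (gtn_eqF hj) andbF addn0.
- by have := slide_q S'; lia.
Qed.

(** * Conjugate partitions *)

(** For [a] weakly decreasing on [1, ..., n.+1] with [a n.+1 = 0], the conjugate
    of the partition [a 1, ..., a n]: the parts of length at least [j] number
    [a j].  With [a] the last ladder, it lists the indices [i] of the operations
    [A_i] in the Fourier transform, each repeated as often as its exponent
    says. *)
Definition conjugate (a : nat -> nat) n :=
  flatten [seq nseq (a i - a i.+1) i | i <- rev (iota 1 n)].

Lemma conjugateS a n :
  conjugate a n.+1 = nseq (a n.+1 - a n.+2) n.+1 ++ conjugate a n.
Proof. by rewrite /conjugate -[n.+1]addn1 iotaD rev_cat /= add1n addn1. Qed.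

Lemma conjugate_range a n : all (fun q => 0 < q <= n) (conjugate a n).
Proof.
elim: n => // n IH; rewrite conjugateS all_cat; apply/andP; split.
  by rewrite all_nseq; apply/orP; right; lia.
by apply: sub_all IH => q; lia.
Qed.

Lemma count_leq_out n s j : all (fun q => 0 < q <= n) s -> n < j ->
  count (leq j) s = 0.
Proof.
move=> rs nj; apply/eqP; rewrite -leqn0 leqNgt -has_count.
by apply/hasPn => q /(allP rs); lia.
Qed.

Lemma conjugate_sorted a n : sorted geq (conjugate a n).
Proof.
elim: n => // n IH; rewrite conjugateS.
elim: (_ - _) => [//|k IHk] /=.
rewrite path_min_sorted //; apply/allP => q; rewrite mem_cat mem_nseq.
case/orP => [/andP[_ /eqP->]|]; first exact: leqnn.
by move/(allP (conjugate_range a n)) => /=; lia.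
Qed.

Lemma count_conjugate a n j : (forall i, 0 < i <= n -> a i.+1 <= a i) ->
  0 < j <= n.+1 -> count (leq j) (conjugate a n) = a j - a n.+1.
Proof.
elim: n j => [|n IH] j mono hj; first by have -> : j = 1 by [lia]; rewrite subnn.
rewrite conjugateS count_cat count_nseq.
have le1 : a n.+2 <= a n.+1 by apply: mono; lia.
have [jn|nj] := leqP j n.+1; last first.
  have -> : j = n.+2 by lia.
  by rewrite mul0n subnn (count_leq_out (conjugate_range a n)).
rewrite IH; [|by move=> i hi; apply: mono; lia|lia].
suff : a n.+1 <= a j by lia.
have [t et] : exists t, t = n.+1 - j by eexists.
elim: t j et jn hj => [|t IHt] j et jn hj.
  by have -> : j = n.+1 by lia.
by apply: leq_trans (IHt j.+1 _ _ _) (mono j _); lia.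
Qed.

Lemma eq_sorted_count (s t : seq nat) :
    sorted geq s -> sorted geq t -> all (leq 1) s -> all (leq 1) t ->
  (forall j, 0 < j -> count (leq j) s = count (leq j) t) -> s = t.
Proof.
move=> ss st s0 t0 eqst.
apply: (@sorted_eq _ geq) => //.
- by move=> x y z /= yx xz; apply: leq_trans xz yx.
- by move=> x y; rewrite /= andbC => /anti_leq.
have cS u j : count (leq j) u = count_mem j u + count (leq j.+1) u.
  by elim: u => //= x u ->; lia.
apply/allP => x; rewrite mem_cat => hx; rewrite /=; apply/eqP.
have x0 : 0 < x by case/orP: hx => [/(allP s0)|/(allP t0)].
by have := eqst x x0; rewrite (cS s x) (cS t x) (eqst x.+1) // => /addIn.
Qed.

Lemma conjugate_count n s : sorted geq s -> all (fun q => 0 < q <= n) s ->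
  conjugate (fun j => count (leq j) s) n = s.
Proof.
move=> ss rs; have out := count_leq_out rs.
apply: eq_sorted_count (conjugate_sorted _ _) ss _ _ _.
- by apply: sub_all (conjugate_range _ _) => q /andP[].
- by apply: sub_all rs => q /andP[].
move=> j j0; have [jn|nj] := leqP j n.+1.
  rewrite count_conjugate ?j0 //; first by rewrite (out n.+1) // subn0.
  by move=> i _; apply: sub_count => q /=; apply: ltnW.
by rewrite (out j) ?(count_leq_out (conjugate_range _ _)) // ltnW.
Qed.

Lemma foldl_iter (A : Type) (f : nat -> A -> A) (e : nat -> nat) x s :
  foldl (fun y i => iter (e i) (f i) y) x s =
  foldr f x (flatten [seq nseq (e i) i | i <- rev s]).
Proof.
elim: s x => //= i s IH x; rewrite IH rev_cons map_rcons flatten_rcons foldr_cat.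
by congr foldr; elim: (e i) => //= k ->.
Qed.

(** * The two transforms as peelings *)

Definition ladder n (Y : array n) j := entry Y (n.+1 - j) j.

Lemma fourierE n (Y : array n.+2) : fourier Y =
  foldr (@proc_A n.+2)
    (cup_top (fourier (del_last Y)) [tuple 0 | _ < n.+2]) (conjugate (ladder Y) n.+2).
Proof. exact: foldl_iter. Qed.

Lemma ladder_mono n (Y : array n) i : triangular Y -> 0 < i <= n ->
  ladder Y i.+1 <= ladder Y i.
Proof.
case: i => // i tY hi; rewrite /ladder subSS subSn; last by lia.
by move/triangularP: tY; apply.
Qed.

Lemma count_ladder n (Y : array n) j : triangular Y -> 0 < j <= n ->
  count (leq j) (conjugate (ladder Y) n) = ladder Y j.
Proof.
move=> tY hj; rewrite count_conjugate; last by lia.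
  by rewrite {2}/ladder subnn entry_out ?subn0.
by move=> i; apply: ladder_mono.
Qed.

Lemma weight_del_last n (Y : array n.+1) i : 0 < i <= n.+1 ->
  weight Y i = weight (del_last Y) i + entry Y i (n.+2 - i).
Proof.
move=> hi; rewrite /weight big_nat_recr /=; last by lia.
congr (_ + _); have -> : n.+2 - i = (n.+1 - i).+1 by lia.
by apply: eq_big_nat => j hj; rewrite entry_del_last ifT //; lia.
Qed.

Lemma weight_del_top n (Y : array n.+1) i : 0 < i ->
  weight (del_top Y) i = weight Y i.+1.
Proof. by move=> i0; apply: eq_bigr => j _; rewrite entry_del_top i0. Qed.

Lemma triangular_del_last n (Y : array n.+1) : triangular Y -> triangular (del_last Y).
Proof.
move=> tY; apply/triangularP => i j; rewrite !entry_del_last.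
have -> : i + j.+2 = i.+1 + j.+1 by lia.
by case: ifP => // _; move/triangularP: tY.
Qed.

Lemma entry_cup_top0 n (Y : array n) i j :
  entry (cup_top Y [tuple 0 | _ < n.+1]) i j = entry Y i.-1 j.
Proof.
rewrite entry_cup_top; case: eqP => // ->; rewrite [RHS]entry_out //.
case: ifP => // j0; have [jn|jn] := ltnP j.-1 n.+1.
  by rewrite -[j.-1]/(nat_of_ord (Ordinal jn)) -tnth_nth tnth_mktuple.
by rewrite nth_default ?size_tuple.
Qed.

Lemma triangular_cup_top0 n (Y : array n) : triangular Y ->
  triangular (cup_top Y [tuple 0 | _ < n.+1]).
Proof.
move=> tY; apply/triangularP => i j; rewrite !entry_cup_top0.
case: i => [|i] /=; first by rewrite entry_out.
by move/triangularP: tY.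
Qed.

Lemma cup_top0K n (Y : array n) : del_top (cup_top Y [tuple 0 | _ < n.+1]) = Y.
Proof.
apply: array_eq => i j; rewrite entry_del_top entry_cup_top0.
by case: i => //=; rewrite entry_out.
Qed.

Lemma del_topK n (Z : array n.+1) : (forall j, entry Z 1 j = 0) ->
  cup_top (del_top Z) [tuple 0 | _ < n.+1] = Z.
Proof.
move=> Z0; apply: array_eq => i j; rewrite entry_cup_top0 entry_del_top.
by case: i => [|[|i]] //=; rewrite ?Z0 ?entry_out.
Qed.

Lemma entry_cup_last_count n (Y : array n) qs i j :
  entry (cup_last Y [tuple count (fun q => k.+1 <= q) qs | k < n.+1]) i j =
    if [&& i + j == n.+2, 0 < i & 0 < j] then count (leq j) qs else entry Y i j.
Proof.
rewrite entry_cup_last; case: ifP => // /and3P[/eqP ij i0 j0].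
have jn : j.-1 < n.+1 by lia.
rewrite -[j.-1]/(nat_of_ord (Ordinal jn)) -tnth_nth tnth_mktuple /=.
by rewrite prednK.
Qed.

Lemma fourier_invE n (Y Z : array n.+2) qs : peeling Y qs Z ->
  fourier_inv Y = cup_last (fourier_inv (del_top Z))
                    [tuple count (fun q => k.+1 <= q) qs | k < n.+2].
Proof.
move=> P; have -> : fourier_inv Y =
  let: (X, qs) := B_seq Y (tnth (dimv Y) ord0) in
  cup_last (fourier_inv (del_top X)) [tuple count (fun q => k.+1 <= q) qs | k < n.+2].
  by [].
by rewrite tnth_dimv (peeling_size P) (peeling_B_seq P).
Qed.

(** The transform is built as a peeling, so [B] recovers its lengths and the
    array it started from; conjugating the lengths gives back the last
    ladder. *)
Lemma fourier_spec n (Y : array n) : triangular Y ->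
  [/\ triangular (fourier Y),
      forall i, 0 < i <= n -> weight (fourier Y) i = weight Y (n.+1 - i)
    & fourier_inv (fourier Y) = Y].
Proof.
elim: n Y => [|[|n] IH] Y tY; first by split=> // i; lia.
  by split=> // i hi; have -> : i = 1 by lia.
have [tT wT TK] := IH _ (triangular_del_last tY).
set Z := cup_top (fourier (del_last Y)) [tuple 0 | _ < n.+2].
have Z0 j : entry Z 1 j = 0 by rewrite entry_cup_top0 entry_out.
have P : peeling (fourier Y) (conjugate (ladder Y) n.+2) Z.
  rewrite fourierE; apply: peeling_of_foldr => //.
  - exact: triangular_cup_top0.
  - exact: conjugate_sorted.
  - exact: conjugate_range.
split; first exact: peeling_src P.
- move=> i hi; rewrite (peeling_weight P); last by lia.
  rewrite count_ladder // (weight_del_last Y); last by lia.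
  congr (_ + _); last by rewrite /ladder; congr entry; lia.
  case: i hi => [//|[|i]] hi.
    by rewrite (weight1_eq0 Z).2 // /weight subn1 subnn big_geq.
  rewrite -weight_del_top // cup_top0K wT; last by lia.
  by congr weight; lia.
- rewrite (fourier_invE P) cup_top0K TK; apply: array_eq => i j.
  rewrite entry_cup_last_count; case: ifP => [/and3P[/eqP ij i0 j0]|off].
    by rewrite count_ladder // /ladder; [congr entry|]; lia.
  rewrite entry_del_last; case: ifP => // ij.
  by rewrite entry_out // /in_triangle; lia.
Qed.

(** The last ladder of the result is the conjugate of the lengths delivered by
    [B]; conjugating it again restores these lengths, and [A] undoes the
    peeling. *)
Lemma fourier_inv_spec n (Y : array n) : triangular Y ->
  [/\ triangular (fourier_inv Y),
      forall i, 0 < i <= n -> weight (fourier_inv Y) i = weight Y (n.+1 - i)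
    & fourier (fourier_inv Y) = Y].
Proof.
elim: n Y => [|[|n] IH] Y tY; first by split=> // i; lia.
  by split=> // i hi; have -> : i = 1 by lia.
have [qs [Z P]] := peeling_exists tY.
have [tW wW WK] := IH _ (triangular_del_top (peeling_tgt P)).
rewrite (fourier_invE P).
set W := fourier_inv (del_top Z) in tW wW WK *; set R := cup_last W _.
have RE := entry_cup_last_count W qs.
have dR : del_last R = W.
  apply: array_eq => i j; rewrite entry_del_last RE.
  case: ifP => ij; first by rewrite ifF //; lia.
  by rewrite entry_out // /in_triangle; lia.
have lR j : 0 < j -> ladder R j = count (leq j) qs.
  move=> j0; have [jn|nj] := leqP j n.+2; first by rewrite /ladder RE ifT //; lia.
  rewrite /ladder entry_out; last by rewrite /in_triangle; lia.
  by rewrite (count_leq_out (peeling_range P)).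
split.
- apply/triangularP => i j; rewrite !RE.
  case: (i =P 0) => [->|i0]; first by rewrite ifF ?[entry _ 0 _]entry_out //; lia.
  have -> : i + j.+2 = i.+1 + j.+1 by lia.
  have -> : 0 < i by lia.
  case: ifP => _; last by move/triangularP: tW.
  by apply: sub_count => q /=; apply: ltnW.
- move=> i hi; rewrite weight_del_last // dR RE ifT; last by lia.
  rewrite (peeling_weight P); last by lia.
  congr (_ + _); have [->|ni] := eqVneq i n.+2.
    rewrite subSnn (weight1_eq0 Z).2 ?(peeling_top0 P) //.
      by rewrite /weight subnn big_geq.
    exact: peeling_top0 P.
  rewrite wW; last by lia.
  by rewrite weight_del_top; [congr weight|]; lia.
- rewrite fourierE dR WK del_topK; last exact: peeling_top0 P.
  rewrite -[RHS](peeling_foldr P); congr foldr.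
  rewrite -[RHS](@conjugate_count n.+2); last 2 first.
  + exact: peeling_sorted P.
  + exact: peeling_range P.
  congr flatten; apply/eq_in_map => j; rewrite mem_rev mem_iota => hj.
  by rewrite (lR j) ?(lR j.+1) //; lia.
Qed.

Lemma dimv_rev n (X Y : array n) (w : n.-tuple nat) :
    (forall i, 0 < i <= n -> weight X i = weight Y (n.+1 - i)) ->
  dimv Y = w -> dimv X = rev_tuple w.
Proof.
move=> wXY dY; apply: eq_from_tnth => k.
rewrite tnth_dimv wXY; last by rewrite ltn_ord.
rewrite (tnth_nth 0) /= nth_rev ?size_tuple //.
have kn : n - k.+1 < n by have := ltn_ord k; lia.
have -> : nth 0 w (n - k.+1) = tnth w (Ordinal kn) by rewrite (tnth_nth 0).
rewrite -dY tnth_dimv; congr weight.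
by have := ltn_ord k; rewrite /=; lia.
Qed.

Lemma rev_tupleK n (w : n.-tuple nat) : rev_tuple (rev_tuple w) = w.
Proof. by apply: val_inj; rewrite /= revK. Qed.

Theorem theorem5p5 (n : nat) (hn : 1 <= n) (w : n.-tuple nat) :
  [/\ set_bij (PP w) (PP (rev_tuple w)) (@fourier n),
      set_bij (PP (rev_tuple w)) (PP w) (@fourier_inv n),
      {in PP w, cancel (@fourier n) (@fourier_inv n)}
    & {in PP (rev_tuple w), cancel (@fourier_inv n) (@fourier n)}].
Proof.
have TP v : set_fun (PP v) (PP (rev_tuple v)) (@fourier n).
  by move=> Y [tY dY]; have [tT wT _] := fourier_spec tY; split=> //; apply: dimv_rev dY.
have T'P v : set_fun (PP v) (PP (rev_tuple v)) (@fourier_inv n).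
  by move=> Y [tY dY]; have [tT wT _] := fourier_inv_spec tY; split=> //; apply: dimv_rev dY.
have TK v : {in PP v, cancel (@fourier n) (@fourier_inv n)}.
  by move=> Y /set_mem[tY _]; have [] := fourier_spec tY.
have T'K v : {in PP v, cancel (@fourier_inv n) (@fourier n)}.
  by move=> Y /set_mem[tY _]; have [] := fourier_inv_spec tY.
have T'Pw : set_fun (PP (rev_tuple w)) (PP w) (@fourier_inv n).
  by rewrite -{2}[w]rev_tupleK; apply: T'P.
split=> //; split=> //.
- exact: can_in_inj (TK w).
- move=> Y PY; exists (fourier_inv Y); first exact: T'Pw.
  by apply: T'K (mem_set PY).
- exact: can_in_inj (T'K (rev_tuple w)).
- move=> Y PY; exists (fourier Y); first exact: TP.
  by apply: TK (mem_set PY).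
Qed.
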